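(* Let $P$ be an $n$-element poset ($n\ge1$), let $k\ge 1$, and let $f_P(q)=\sum_{i=0}^{n-1}a_iq^i$ be the sorting generating function of $P$. Write the sorting generating function of $T_k\oplus P$ as $f_{T_k\oplus P}(q)=\sum_{i=0}^{n+k-1}a_i'q^i$. Let $v=(a_0,a_1,\dots,a_{n-1})^{\intercal}$ and $v'=(a_0',a_1',\dots,a_{n-1}')^{\intercal}$ (the first $n$ coefficients of $f_{T_k\oplus P}(q)$). Let $X_n(k)$ be the lower-triangular $n\times n$ matrix with $(i,j)$ entry ($1\le i,j\le n$) $$x_{ij}=\begin{cases}k!\binom{k+i-2}{k-1}&\text{if } i>j,\\ k!\binom{k+i-1}{k}&\text{if } i=j,\\ 0&\text{otherwise.}\end{cases}$$ Then 1. $X_n(k)\,v=v'$; 2. $a_n'=n!\,k!\binom{n+k-1}{k-1}$; 3. $a_i'=0$ for $i=n+1,n+2,\dots,n+k-1$.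
   Context: Let $P$ be a finite poset with $n$ elements. A labeling of $P$ is a bijection $L:P\to\{1,\dots,n\}$; $\Lambda(P)$ is the set of all labelings. $L$ is natural if $x<_P y$ implies $L(x)<L(y)$. The (extended) promotion $\partial L$ of a labeling $L$ is obtained as follows: (1) repeat until the element labeled $1$ is maximal: let $u$ be the element labeled $1$ and let $v$ be the element with the smallest label among all elements $v>_P u$; swap the labels of $u$ and $v$; (2) then simultaneously replace the label $1$ by $n$ and each label $i>1$ by $i-1$. The order $\mathrm{or}(L)$ is the smallest $k\ge 0$ such that $\partial^k L$ is natural (it is known that the order is always at most $n-1$). The sorting generating function of an $n$-element poset $P$ is $f_P(q)=\sum_{L\in\Lambda(P)}q^{\mathrm{or}(L)}=\sum_{i=0}^{n-1}a_iq^i$, where $a_i$ is the number of labelings of order $i$. $T_k$ denotes the antichain on $k$ elements. The ordinal sum $P\oplus Q$ is the poset on the disjoint union $P\sqcup Q$ in which $s\le t$ iff $s,t\in P$ and $s\le_P t$, or $s,t\in Q$ and $s\le_Q t$, or $s\in P$ and $t\in Q$ (so $T_k\oplus P$ is $P$ with $k$ new minimal elements attached below everything). *)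

(* Defs.v *)
From HB Require Import structures.
From mathcomp Require Import all_boot all_order all_fingroup all_algebra.
From mathcomp Require Import zify.

Set Implicit Arguments.
Unset Strict Implicit.
Unset Printing Implicit Defensive.

Import Order.TTheory GRing.Theory Num.Theory.

Local Open Scope nat_scope.

(* Labels are 0-based: the value i : 'I_#|T| stands for the label i + 1, so
   "the element labeled 1" is the element of value 0.  An injection between
   sets of the same cardinality is a bijection. *)
Record labeling (T : finType) := Labeling {
  labeling_fun :> {ffun T -> 'I_#|T|};
  labeling_inj : injectiveb labeling_fun
}.

HB.instance Definition _ (T : finType) := [isSub for @labeling_fun T].
HB.instance Definition _ (T : finType) := [Finite of labeling T by <:].

Lemma labelingP (T : finType) (L : labeling T) : injective L.
Proof. exact/injectiveP/labeling_inj. Qed.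

Lemma swap_labels_subproof (T : finType) (L : labeling T) (u v : T) :
  injectiveb [ffun x => L (tperm u v x)].
Proof.
by apply/injectiveP => x y; rewrite !ffunE => /labelingP/perm_inj.
Qed.

Definition swap_labels (T : finType) (u v : T) (L : labeling T) : labeling T :=
  Labeling (swap_labels_subproof L u v).

Lemma cycle_labels_subproof (T : finType) (L : labeling T) :
  injectiveb [ffun x => ord_pred (L x)].
Proof.
by apply/injectiveP => x y; rewrite !ffunE => /ord_pred_inj/labelingP.
Qed.

(* [ord_pred] sends 0 to #|T|.-1 and i.+1 to i. *)
Definition cycle_labels (T : finType) (L : labeling T) : labeling T :=
  Labeling (cycle_labels_subproof L).

Lemma cycle_labelsE (T : finType) (L : labeling T) (x : T) :
  cycle_labels L x = (if L x == 0 :> nat then #|T|.-1 else (L x).-1) :> nat.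
Proof.
rewrite ffunE /=; have := ltn_ord (L x); case: (val (L x)) => [|m] /= lt_m.
  by rewrite ?add0n modn_small //; case: #|T| lt_m.
by rewrite ?addSn /= modnDr modn_small // ltnW.
Qed.

Section Promotion.

Variables (d : Order.disp_t) (T : finPOrderType d).
Implicit Types (L : labeling T) (u v w x y : T).

Definition natural_labeling L := [forall x : T, forall y : T, (x < y)%O ==> (L x < L y)].

Definition next_label L u v :=
  (u < v)%O && [forall w : T, (u < w)%O ==> (L v <= L w)].

Definition slide L : labeling T :=
  if [pick u | L u == 0 :> nat] is Some u then
    if [pick v | next_label L u v] is Some v then swap_labels u v L else L
  else L.

(* A chain has at most #|T| elements, so #|T| iterations of [slide] reach the
   point where the element labeled 1 is maximal (see [slide_iter_maximal]);
   from then on [slide] is the identity. *)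
Definition promotion L : labeling T := cycle_labels (iter #|T| slide L).

Variant slide_spec L : labeling T -> Prop :=
| SlideMaximal of (forall u v, L u = 0 :> nat -> ~~ (u < v)%O) :
    slide_spec L L
| SlideSwap u v of L u = 0 :> nat & (u < v)%O &
    (forall w, (u < w)%O -> L v <= L w) : slide_spec L (swap_labels u v L).

Lemma slideP L : slide_spec L (slide L).
Proof.
rewrite /slide; case: pickP => [u /eqP Lu0 | no0]; last first.
  by apply: SlideMaximal => u v Lu0; move: (no0 u); rewrite Lu0 eqxx.
case: pickP => [v /andP[lt_uv /forallP min_v] | no_v].
  by apply: SlideSwap => // w lt_uw; apply: (implyP (min_v w)).
apply: SlideMaximal => u' v Lu'0; have -> : u' = u.
  by apply: (@labelingP _ L); apply: val_inj; rewrite /= Lu'0.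
apply/negP => lt_uv.
case: (@arg_minnP _ v (fun w => (u < w)%O) (fun w => val (L w)) lt_uv) => w.
move=> lt_uw min_w.
move: (no_v w); rewrite /next_label lt_uw /=; move/negbT/forallPn => [z].
by rewrite negb_imply => /andP[lt_uz]; rewrite min_w.
Qed.

Lemma swap_labelsE L u v x : swap_labels u v L x =
  (if x == u then L v else if x == v then L u else L x).
Proof. by rewrite ffunE; case: tpermP => [->|->|/eqP/negPf-> /eqP/negPf->];
  rewrite ?eqxx //; case: eqP => // ->. Qed.

Lemma slide_iter_maximal L u v :
  iter #|T| slide L u = 0 :> nat -> ~~ (u < v)%O.
Proof.
have up k : (forall x y, iter k slide L x = 0 :> nat -> ~~ (x < y)%O) \/
    (forall x, iter k slide L x = 0 :> nat -> k <= #|[pred y | (y < x)%O]|).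
  elim: k => [|k IHk]; first by right.
  rewrite iterS; set M := iter k slide L in IHk *; case: slideP => [|u' v' M0].
    by left.
  move=> lt_uv _; right=> x; rewrite swap_labelsE; case: eqP => [_ Mv0 | ne_xu].
    have /labelingP eq_uv : M v' = M u' by apply: val_inj; rewrite /= Mv0.
    by rewrite eq_uv ltxx in lt_uv.
  case: eqP => [-> _ | ne_xv Mx0]; last first.
    case: ne_xu; apply: (@labelingP _ M); apply: val_inj.
    by rewrite /= Mx0.
  case: IHk => [/(_ _ v' M0)|/(_ _ M0) le_k]; first by rewrite lt_uv.
  apply: leq_ltn_trans le_k _; apply/proper_card/properP; split.
    by apply/subsetP => y; rewrite !inE => /lt_trans; apply.
  by exists u'; rewrite !inE ?ltxx.
case: (up #|T|) => [/(_ u v) //| /(_ u) le_T] /le_T; rewrite leqNgt.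
move=> /negP[]; apply/proper_card/properP; split; first exact/subsetP.
by exists u; rewrite !inE ?ltxx.
Qed.

Definition top_sorted i L := forall x y,
  (x < y)%O -> #|T| - i <= L x -> L x < L y.

Lemma slide_top_sorted i L : i < #|T| ->
  (forall x y, (x < y)%O -> #|T| - i <= L x -> L x < L y \/ L y = 0 :> nat) ->
  (forall x y, (x < y)%O -> #|T| - i <= slide L x ->
     slide L x < slide L y \/ slide L y = 0 :> nat).
Proof.
move=> lt_i sL; case: slideP => [//|u v Lu0 lt_uv min_v] x y lt_xy.
have Linj a b : L a = L b :> nat -> a = b by move/val_inj/labelingP.
rewrite !swap_labelsE; case: (eqVneq x u) => [eq_x | ne_xu].
  subst x; rewrite (gt_eqF lt_xy) => _.
  case: (eqVneq y v) => [_|ne_yv]; first by right.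
  left; rewrite ltn_neqAle min_v // andbT.
  by apply: contra_neq ne_yv => /Linj ->.
case: (eqVneq x v) => [_|ne_xv]; first by rewrite Lu0; lia.
move=> le_x; case: (eqVneq y u) => [eq_y | ne_yu]; last first.
  by case: (eqVneq y v) => _; [right | apply: sL].
subst y; left; case: (sL x v (lt_trans lt_xy lt_uv) le_x) => // Lv0.
have eq_uv : u = v by apply: Linj; rewrite Lu0 Lv0.
by rewrite eq_uv ltxx in lt_uv.
Qed.

Lemma promotion_top_sorted i L : i < #|T| ->
  top_sorted i L -> top_sorted i.+1 (promotion L).
Proof.
move=> lt_i sL x y lt_xy; rewrite !cycle_labelsE.
have {sL} iterP k : forall x y, (x < y)%O -> #|T| - i <= iter k slide L x ->
    iter k slide L x < iter k slide L y \/ iter k slide L y = 0 :> nat.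
  elim: k => [|k IHk]; last exact: slide_top_sorted.
  by move=> a b lt_ab le_a; left; apply: sL.
move: (iterP #|T| x y lt_xy); have := @slide_iter_maximal L x y.
set M := iter _ _ _; rewrite lt_xy => Mx.
have := ltn_ord (M x); have := ltn_ord (M y).
case: eqP => [/Mx //|]; case: eqP; lia.
Qed.

Lemma iter_top_sorted i L : i <= #|T| -> top_sorted i (iter i promotion L).
Proof.
elim: i => [_ x y _|i IHi lt_i]; first by rewrite subn0 leqNgt ltn_ord.
by rewrite iterS; apply/promotion_top_sorted/IHi/ltnW.
Qed.

Lemma labeling_order_subproof L : exists k, natural_labeling (iter k promotion L).
Proof.
exists #|T|; apply/'forall_forallP => x y; apply/implyP => lt_xy.
by apply: iter_top_sorted => //; rewrite subnn.
Qed.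

Definition labeling_order L : nat := ex_minn (labeling_order_subproof L).

Lemma labeling_order_le L : labeling_order L <= #|T|.-1.
Proof.
rewrite /labeling_order; case: ex_minnP => m _; apply.
apply/'forall_forallP => x y; apply/implyP => lt_xy.
set M := iter _ _ _; have [Mx0 | Mx_gt0] := posnP (M x); last first.
  by apply: iter_top_sorted => //; [exact: leq_pred | rewrite -/M; lia].
rewrite Mx0 lt0n; apply/eqP => My0.
have /labelingP eq_xy : M x = M y by apply: val_inj; rewrite /= Mx0 My0.
by rewrite eq_xy ltxx in lt_xy.
Qed.

Definition sorting_gf : {poly int} := (\sum_(L : labeling T) 'X^(labeling_order L))%R.

End Promotion.

Definition antichain (k : nat) : Type := 'I_k.

Definition antichain_display : Order.disp_t := Order.Disp tt tt.

Section Antichain.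

Variable k : nat.

HB.instance Definition _ := Finite.on (antichain k).

Definition antichain_le (x y : antichain k) : bool := x == y.

Fact antichain_le_refl : reflexive antichain_le.
Proof. by move=> x; exact: eqxx. Qed.

Fact antichain_le_anti : antisymmetric antichain_le.
Proof. by move=> x y /andP[/eqP]. Qed.

Fact antichain_le_trans : transitive antichain_le.
Proof. by move=> y x z /eqP-> /eqP->; exact: eqxx. Qed.

HB.instance Definition _ := Order.Le_isPOrder.Build antichain_display
  (antichain k) antichain_le_refl antichain_le_anti antichain_le_trans.

End Antichain.

Definition ordinal_sum (S T : Type) : Type := (S + T)%type.

Definition ordinal_sum_display (d1 d2 : Order.disp_t) : Order.disp_t :=
  Order.Disp tt tt.

Section OrdinalSum.

Variables (d1 d2 : Order.disp_t) (S : finPOrderType d1) (T : finPOrderType d2).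

HB.instance Definition _ := Finite.on (ordinal_sum S T).

Definition ordinal_sum_le (x y : ordinal_sum S T) : bool :=
  match x, y with
  | inl s, inl t => (s <= t)%O
  | inr s, inr t => (s <= t)%O
  | inl _, inr _ => true
  | inr _, inl _ => false
  end.

Fact ordinal_sum_le_refl : reflexive ordinal_sum_le.
Proof. by case=> x /=. Qed.

Fact ordinal_sum_le_anti : antisymmetric ordinal_sum_le.
Proof. by case=> x [] y //= /le_anti ->. Qed.

Fact ordinal_sum_le_trans : transitive ordinal_sum_le.
Proof. by case=> y [] x [] z //=; apply: le_trans. Qed.

HB.instance Definition _ := Order.Le_isPOrder.Build (ordinal_sum_display d1 d2)
  (ordinal_sum S T) ordinal_sum_le_refl ordinal_sum_le_anti
  ordinal_sum_le_trans.

End OrdinalSum.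

(* Rows and columns are numbered from 0, so the 1-based indices of the entry at
   (i, j) are i.+1 and j.+1. *)
Definition Xmx (n k : nat) : 'M[int]_n :=
  (\matrix_(i < n, j < n)
    if (j < i)%N then (k`! * 'C(k + i.+1 - 2, k - 1))%N%:R
    else if i == j then (k`! * 'C(k + i.+1 - 1, k))%N%:R
    else 0)%R.

(* Main.v *)
Require Import Defs.
From mathcomp Require Import all_boot all_order all_fingroup all_algebra.
From mathcomp Require Import zify.

(** Let N = n + k be the size of T_k ⊕ P. A labeling L of T_k ⊕ P amounts to
    the word of length N in the letters T and P recording which labels lie in
    which summand, the arrangement of the T-labels, and the labeling
    [restr L] of P obtained by renumbering the labels that lie in P in
    increasing order.

    A promotion deletes the first letter P of the word and appends a P at the
    end, and it acts on [restr L] as promotion of P. This is clear if the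
    smallest label lies in P. If it lies at an element of T_k, that element
    first exchanges it for the smallest label in P, because all of P lies above
    T_k; the exchange does not change [restr L], and the first case applies
    from then on ([promotion_restr]).

    L is natural iff [restr L] is and the word is T...TP...P, that is, all the
    T-labels are among the k smallest ([natural_restr]). Since promotion
    preserves naturality and lowers a bound j + 1 + k on the T-labels to j + k,
    L has order at most i iff [restr L] has and every (0-based) T-label is below
    i + k ([labeling_order_restr_leq]). The labeling of P and the injection giving
    the T-labels can be prescribed independently ([card_restr]), so for
    i <= n + 1
      #{L : or(L) < i} = #{M : or(M) < i} * (i + k - 1)^_k,
    the falling factorial counting the injections of T_k into the labels below
    i + k - 1 ([card_labeling_order_lt]). The stated formulas are the
    successive differences of this identity in i, because
    (i + k)^_k - (i + k - 1)^_k = k! 'C(i + k - 1, k - 1) by Pascal's rule. *)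

Set Implicit Arguments.
Unset Strict Implicit.
Unset Printing Implicit Defensive.

Import Order.TTheory GRing.Theory Num.Theory.

Local Open Scope nat_scope.

(** * Labelings as linear orders *)

Lemma card_ord_lt n m : m <= n -> #|[pred j : 'I_n | j < m]| = m.
Proof.
move=> le_mn; rewrite -sum1_card; under eq_bigl do rewrite inE.
by rewrite (big_ord_narrow le_mn) sum1_card card_ord.
Qed.

Section Labelings.

Variable T : finType.
Implicit Types (L M : labeling T) (x y : T).

Lemma labeling_val_inj L x y : L x = L y :> nat -> x = y.
Proof. by move/val_inj/labelingP. Qed.

(** A labeling is onto, so every smaller label is taken. *)
Lemma labeling_rank L x : L x = #|[pred y | L y < L x]| :> nat.
Proof.
have onto (j : 'I_#|T|) : j \in codom L.
  by apply: inj_card_onto; [exact: labelingP | rewrite card_ord].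
have -> : #|[pred y | L y < L x]| = #|[pred j : 'I_#|T| | j < L x]|.
  rewrite -(card_image (@labelingP _ L)); apply: eq_card => j.
  apply/imageP/idP => [[y lt_y ->] //| lt_j].
  by have /codomP[y def_j] := onto j; exists y; rewrite // inE -def_j.
by rewrite card_ord_lt // ltnW.
Qed.

(** A labeling is determined by the linear order it induces; equalities between
    promoted or restricted labelings are reduced to comparisons in this way. *)
Lemma labeling_ext L M :
  (forall x y, (L x < L y) = (M x < M y)) -> L = M.
Proof.
move=> eqLM; apply: val_inj; apply/ffunP => x; apply: val_inj => /=.
by rewrite (labeling_rank L) (labeling_rank M); apply: eq_card => y; rewrite !inE.
Qed.

Lemma card_labeling : #|{: labeling T}| = #|T|`!.
Proof.
have <- := ffactnn #|T|; have := card_inj_ffuns T 'I_#|T|.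
by rewrite card_ord cardsE card_sub => <-.
Qed.

End Labelings.

(** * Naturality, order and sliding in a poset *)

Section Order.

Variables (d : Order.disp_t) (T : finPOrderType d).
Implicit Types (L : labeling T) (x y : T).

Lemma natural_labelingP L :
  reflect (forall x y, (x < y)%O -> L x < L y) (natural_labeling L).
Proof.
by apply: (iffP 'forall_forallP) => H x y; [apply/implyP | apply/implyP/H].
Qed.

(** Naturality is the sortedness of all labels. It implies sortedness of all
    labels but the smallest, which one more promotion completes. *)
Lemma promotion_natural L : natural_labeling L -> natural_labeling (promotion L).
Proof.
move/natural_labelingP => natL; apply/natural_labelingP => x y lt_xy.
have T_gt0 : 0 < #|T| by apply/card_gt0P; exists x.
apply: (@promotion_top_sorted _ _ #|T|.-1 L) => //; last by rewrite prednK ?subnn.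
  by rewrite prednK.
by move=> a b lt_ab _; apply: natL.
Qed.

Lemma labeling_order_leq L i :
  (labeling_order L <= i) = natural_labeling (iter i (@promotion _ T) L).
Proof.
rewrite /labeling_order; case: ex_minnP => m nat_m min_m.
apply/idP/idP => [le_mi | /min_m //]; rewrite -(subnK le_mi) iterD.
by elim: (i - m) => //= j; apply: promotion_natural.
Qed.

Lemma slide_fix L : (forall x y, L x = 0 :> nat -> ~~ (x < y)%O) -> slide L = L.
Proof.
by move=> max0; case: slideP => // u v Lu0 lt_uv _; case/negP: (max0 u v Lu0).
Qed.

Lemma iter_slide_stable L m : #|T| <= m ->
  iter m (@slide _ T) L = iter #|T| (@slide _ T) L.
Proof.
move=> le_m; rewrite -(subnK le_m) iterD; elim: (m - _) => //= j ->.
by apply: slide_fix; apply: slide_iter_maximal.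
Qed.

End Order.

(** * Restricting labelings of the ordinal sum to its upper summand *)

Section Restriction.

Variables (d : Order.disp_t) (P : finPOrderType d) (k : nat).

Local Notation S := (ordinal_sum (antichain k) P).
Local Notation top x := (inr x : S).
Local Notation bot t := (inl t : S).

Implicit Types (L : labeling S) (x y : P) (t : antichain k).

Lemma card_ordinal_sum : #|{: S}| = k + #|P|.
Proof. by rewrite card_sum card_ord. Qed.

Lemma lt_top x y : (top x < top y)%O = (x < y)%O.
Proof. by rewrite !lt_neqAle (inj_eq inr_inj). Qed.

Lemma lt_bot_top t x : (bot t < top x)%O.
Proof. by rewrite lt_neqAle. Qed.

Lemma lt_bot t t' : (bot t < bot t')%O = false.
Proof. by rewrite lt_neqAle (inj_eq inl_inj) andNb. Qed.

Lemma lt_top_bot t x : (top x < bot t)%O = false.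
Proof. by rewrite lt_neqAle. Qed.

Fact rank_subproof L x : #|[pred y | L (top y) < L (top x)]| < #|P|.
Proof.
apply/proper_card/properP; split; first exact/subsetP.
by exists x; rewrite // inE ltnn.
Qed.

Definition rank L x : 'I_#|P| := Ordinal (rank_subproof L x).

Fact rank_lt L x y : (rank L x < rank L y) = (L (top x) < L (top y)).
Proof.
have rank_mono a b : L (top a) <= L (top b) -> rank L a <= rank L b.
  move=> le_ab; apply/subset_leq_card/subsetP => z; rewrite !inE => lt_z.
  exact: leq_trans lt_z le_ab.
case: (ltnP (L (top x))) => [lt_xy | /rank_mono]; last by rewrite leqNgt => /negPf.
apply/proper_card/properP; split.
  by apply/subsetP => z; rewrite !inE => /ltn_trans; apply.
by exists x; rewrite !inE ?ltnn.
Qed.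

Fact restr_subproof L : injectiveb [ffun x => rank L x].
Proof.
apply/injectiveP => x y; rewrite !ffunE => eq_r.
have := rank_lt L x y; have := rank_lt L y x; rewrite eq_r ltnn.
case: ltngtP => // /labeling_val_inj; congruence.
Qed.

(** The standardization of the labels lying in [P]. *)
Definition restr L : labeling P := Labeling (restr_subproof L).

Lemma restr_lt L x y : (restr L x < restr L y) = (L (top x) < L (top y)).
Proof. by rewrite !ffunE rank_lt. Qed.

Lemma restr_leq L x y : (restr L x <= restr L y) = (L (top x) <= L (top y)).
Proof. by rewrite leqNgt restr_lt -leqNgt. Qed.

Lemma card_sum_pred (p : pred S) :
  #|p| = #|[pred t | p (bot t)]| + #|[pred x | p (top x)]|.
Proof. by rewrite -!sum1_card big_sumType. Qed.

Lemma label_top L x :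
  L (top x) = restr L x + #|[pred t | L (bot t) < L (top x)]| :> nat.
Proof. by rewrite {1}labeling_rank card_sum_pred addnC !ffunE. Qed.

(** * Promotion of the ordinal sum *)

Definition zero_on_top L := exists u : P, L (top u) = 0 :> nat.

Lemma restr_eq0 L x : zero_on_top L ->
  (restr L x == 0 :> nat) = (L (top x) == 0 :> nat).
Proof.
case=> u Lu0; rewrite -!leqn0 -{2}Lu0 -restr_leq.
suff -> : restr L u = 0 :> nat by [].
by have := label_top L u; rewrite Lu0; case: (nat_of_ord (restr L u)).
Qed.

(** Everything above an element of [P] is in [P], and [restr] preserves
    comparisons, so once the smallest label is in [P] both slides choose the
    same element to exchange it with. *)
Lemma slide_restr L : zero_on_top L ->
  [/\ zero_on_top (slide L), restr (slide L) = slide (restr L) &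
      forall t, slide L (bot t) = L (bot t)].
Proof.
move=> zL; have [u Lu0] := zL.
have zr x : restr L x = 0 :> nat -> x = u.
  move/eqP; rewrite restr_eq0 // => /eqP Lx0.
  by apply/inr_inj/(@labeling_val_inj _ L); rewrite Lx0 Lu0.
have ru0 : restr L u = 0 :> nat by apply/eqP; rewrite restr_eq0 // Lu0.
case: (slideP L) => [max0 | u' v' Lu'0 lt_uv min_v].
  split=> //; rewrite slide_fix // => x y /zr ->.
  by have := max0 _ (top y) Lu0; rewrite lt_top.
have eq_u : u' = top u by apply: (@labeling_val_inj _ L); rewrite Lu0 Lu'0.
subst u'; case: v' lt_uv min_v => [t|v]; first by rewrite lt_top_bot.
rewrite lt_top => lt_uv min_v.
have ne_vu : v != u by rewrite (gt_eqF lt_uv).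
have sw_top x : swap_labels (top u) (top v) L (top x) = L (top (tperm u v x)).
  rewrite swap_labelsE !(inj_eq inr_inj).
  by case: tpermP => [->|->|/eqP/negPf-> /eqP/negPf->]; rewrite ?eqxx ?(negPf ne_vu).
split=> [||t]; last by rewrite swap_labelsE.
  by exists v; rewrite sw_top tpermR.
case: slideP => [/(_ u v ru0)/negP[] // | u2 v2 /zr -> lt_uv2 min_v2].
have <- : v = v2.
  apply/(@labeling_val_inj _ (restr L))/eqP; rewrite eqn_leq min_v2 // andbT.
  by rewrite restr_leq min_v // lt_top.
by apply: labeling_ext => x y; rewrite restr_lt !sw_top -restr_lt !ffunE.
Qed.

Lemma iter_slide_restr m L : zero_on_top L ->
  [/\ zero_on_top (iter m (@slide _ S) L),
      restr (iter m (@slide _ S) L) = iter m (@slide _ P) (restr L) &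
      forall t, iter m (@slide _ S) L (bot t) = L (bot t)].
Proof.
move=> zL; elim: m => //= m [zM <- eqM].
by have [zS eqS botS] := slide_restr zM; split=> // t; rewrite botS eqM.
Qed.

(** The labels below the smallest one of [P] all lie in the antichain. *)
Lemma min_top_leq L x : (forall y, L (top x) <= L (top y)) -> L (top x) <= k.
Proof.
move=> min_x; rewrite labeling_rank card_sum_pred.
have -> : #|[pred y | [pred z | L z < L (top x)] (top y)]| = 0.
  by apply: eq_card0 => y; rewrite !inE ltnNge min_x.
by rewrite addn0 (leq_trans (max_card _)) // card_ord.
Qed.

(** The element of the antichain that loses the smallest label receives the
    smallest label of [P], which is at most [k]; hence no bound of the form
    [j + k] on the labels of the antichain is affected. *)
Lemma slide_bot L t0 : 0 < #|P| -> L (bot t0) = 0 :> nat ->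
  [/\ zero_on_top (slide L), restr (slide L) = restr L &
      forall j, (forall t, slide L (bot t) <= j + k) <->
                (forall t, L (bot t) <= j + k)].
Proof.
case/card_gt0P => x0 _ L0.
case: slideP => [/(_ _ (top x0) L0)|u v Lu0 lt_uv min_v].
  by rewrite lt_bot_top.
have eq_u : u = bot t0 by apply: (@labeling_val_inj _ L); rewrite L0.
subst u; case: v lt_uv min_v => [t1|x _ min_x]; first by rewrite lt_bot.
have min_top y : L (top x) <= L (top y) by apply/min_x/lt_bot_top.
have sw_top y : swap_labels (bot t0) (top x) L (top y) =
    (if y == x then 0 else L (top y)) :> nat.
  by rewrite swap_labelsE /= (inj_eq inr_inj); case: eqP.
split; first by exists x; rewrite sw_top eqxx.
  apply: labeling_ext => y z; rewrite !restr_lt !sw_top.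
  have Ltop_neq y' : y' != x -> L (top x) < L (top y').
    move=> ne; rewrite ltn_neqAle min_top andbT.
    by apply: contra_neq ne => /labeling_val_inj[].
  case: (eqVneq y x) => [->|/Ltop_neq ney]; case: (eqVneq z x) => [->|/Ltop_neq nez] //.
    by rewrite !ltnn.
    by rewrite nez; apply: leq_trans nez.
  by rewrite ltn0 ltnNge (ltnW ney).
move=> j; split=> bnd t; have := bnd t; rewrite swap_labelsE (inj_eq inl_inj) //.
  by case: eqP => // -> _; rewrite L0.
by case: eqP => // _ _; rewrite (leq_trans (min_top_leq min_top)) ?leq_addl.
Qed.

(** Both claims are read off a labeling [M] which has the smallest label in [P],
    from which the slides of [L] continue: [M] is [L] itself, or [slide L] if
    the smallest label of [L] is in the antichain. In the latter case at least
    [#|P|] slides remain because the antichain is nonempty. *)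
Lemma promotion_restr L : 0 < #|P| -> 0 < k ->
  restr (promotion L) = promotion (restr L) /\
  forall j, (forall t, promotion L (bot t) < j + k) <->
            (forall t, L (bot t) < j.+1 + k).
Proof.
move=> P_gt0 k_gt0.
have [M [m [zM rM leM le_m iterM]]] : exists M m, [/\ zero_on_top M,
    restr M = restr L, (forall j, (forall t, M (bot t) <= j + k) <->
                                  (forall t, L (bot t) <= j + k)),
    #|P| <= m & iter #|{: S}| (@slide _ S) L = iter m (@slide _ S) M].
  have [x0 _] := card_gt0P P_gt0.
  have N_gt0 : 0 < #|{: S}| by rewrite card_ordinal_sum addn_gt0 k_gt0.
  have /codomP[z Lz] : Ordinal N_gt0 \in codom L.
    by apply: inj_card_onto; [exact: labelingP | rewrite card_ord].
  case: z Lz => [t|u] Lz.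
    exists (slide L), #|{: S}|.-1.
    have [zS rS leS] := slide_bot P_gt0 (esym (congr1 val Lz)).
    split=> //; first by rewrite card_ordinal_sum; lia.
    by rewrite -iterSr prednK.
  exists L, #|{: S}|; split=> //; first by exists u; rewrite -Lz.
  by rewrite card_ordinal_sum leq_addl.
have [zN rN botN] := iter_slide_restr m zM.
split; last first.
  move=> j; rewrite /promotion iterM.
  transitivity (forall t, M (bot t) <= j + k); last first.
    by rewrite leM; split=> H t; have := H t; lia.
  have [u Nu0] := zN.
  have Mbot t : 0 < M (bot t).
    by rewrite -botN lt0n -Nu0; apply/eqP => /labeling_val_inj.
  have cM t : (cycle_labels (iter m (@slide _ S) M) (bot t) < j + k) =
      (M (bot t) <= j + k).
    by rewrite cycle_labelsE botN gtn_eqF // -ltnS prednK.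
  by split=> H t; have := H t; rewrite cM.
rewrite /promotion iterM -rM -(iter_slide_stable _ le_m) -rN.
set N := iter m _ M in zN rN *.
apply: labeling_ext => x y; rewrite restr_lt !cycle_labelsE !restr_eq0 //.
have := restr_lt N x y; have := ltn_ord (N (top x)); have := ltn_ord (N (top y)).
have := ltn_ord (restr N x); have := ltn_ord (restr N y).
have := restr_eq0 x zN; have := restr_eq0 y zN.
move: (nat_of_ord (N _)) (nat_of_ord (N _)) (nat_of_ord (restr N _)) => a b.
move: (nat_of_ord (restr N _)) => e f.
by case: (eqVneq a 0); case: (eqVneq b 0) => ? ? /eqP ? /eqP ?; lia.

Qed.

(** If the [k] labels of the antichain are below [k], they exhaust the labels
    below [k], which leaves only larger labels to [P]. *)
Lemma natural_restr L :
  natural_labeling L <-> natural_labeling (restr L) /\ forall t, L (bot t) < k.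
Proof.
split=> [/natural_labelingP natL | [/natural_labelingP natL bnd]].
  split; first by apply/natural_labelingP => x y lt_xy; rewrite restr_lt natL ?lt_top.
  move=> t; rewrite labeling_rank card_sum_pred -[X in _ < X]addn0.
  rewrite [X in _ + X]eq_card0 => [|y]; last by rewrite !inE ltnNge ltnW ?natL ?lt_bot_top.
  rewrite ltn_add2r -[X in _ < X]card_ord.
  apply/proper_card/properP; split; first exact/subsetP.
  by exists t; rewrite // !inE ltnn.
apply/natural_labelingP => -[t|x] [t'|y]; rewrite ?lt_bot ?lt_top_bot ?lt_top //.
- move=> _; rewrite ltnNge; apply/negP => le_y.
  have [e Ue size_e] : exists2 e : seq (antichain k), uniq e & size e = k.
    by exists (enum {: antichain k}); [exact: enum_uniq | rewrite -cardE card_ord].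
  pose s := top y :: map (fun t => bot t) e.
  have Us : uniq (map (fun z => val (L z)) s).
    rewrite map_inj_uniq => [|a b /labeling_val_inj //].
    rewrite /= (map_inj_uniq inl_inj) Ue andbT.
    by apply/mapP => -[].
  have sub_s : {subset map (fun z => val (L z)) s <= iota 0 k}.
    move=> _ /mapP[z zs ->]; rewrite mem_iota /=.
    move: zs; rewrite inE => /predU1P[-> | /mapP[t' _ ->]]; last exact: bnd.
    exact: leq_ltn_trans le_y (bnd t).
  by have := uniq_leq_size Us sub_s; rewrite /= !size_map size_e size_iota ltnn.
- by move=> lt_xy; rewrite -restr_lt natL.
Qed.

Lemma iter_promotion_natural L i : 0 < #|P| -> 0 < k ->
  natural_labeling (iter i (@promotion _ S) L) <->
  natural_labeling (iter i (@promotion _ P) (restr L)) /\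
    forall t, L (bot t) < i + k.
Proof.
move=> P_gt0 k_gt0; elim: i L => [|i IHi] L; first exact: natural_restr.
have [rL bL] := promotion_restr L P_gt0 k_gt0.
by rewrite !iterSr IHi rL bL.
Qed.

Lemma labeling_order_restr_leq L i : 0 < #|P| -> 0 < k ->
  (labeling_order L <= i) =
  (labeling_order (restr L) <= i) && [forall t, L (bot t) < i + k].
Proof.
move=> P_gt0 k_gt0; rewrite !labeling_order_leq.
apply/idP/andP => [|[nat_r /forallP bnd]]; rewrite iter_promotion_natural //.
by case=> nat_r bnd; split=> //; apply/forallP.
Qed.

(** * Counting the labelings of the ordinal sum *)

(** Equal labels on the antichain leave the same label set to [P], so some map
    [s] on [P] carries [L] to [L'] there. It is an automorphism of the linear
    order that is the common restriction, hence the identity. *)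
Lemma restr_bot_inj L L' :
  restr L = restr L' -> (forall t, L (bot t) = L' (bot t)) -> L = L'.
Proof.
move=> eq_r eq_bot.
have [s sP] : exists s : P -> P, forall x, L (top x) = L' (top (s x)).
  apply: (fin_all_exists (P := fun x y => L (top x) = L' (top y))) => x.
  have /codomP[[t|y] Lx] : L (top x) \in codom L'; last by exists y.
    by apply: inj_card_onto; [exact: labelingP | rewrite card_ord].
  by move: Lx; rewrite -eq_bot => /labelingP.
have s_inj : injective s.
  move=> x y eq_s; apply/inr_inj/(@labelingP _ L).
  by rewrite !sP eq_s.
have inj_s : injectiveb [ffun x => restr L' (s x)].
  by apply/injectiveP => x y; rewrite !(ffunE (fun x => restr L' (s x))) => /labelingP/s_inj.
have eq_Ls : restr L = Labeling inj_s.
  apply: labeling_ext => x y; rewrite restr_lt !sP -restr_lt.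
  by rewrite [in RHS]/= !(ffunE (fun x => restr L' (s x))).
have s_id x : s x = x.
  apply/esym/(@labelingP _ (restr L)); rewrite [in RHS]eq_r eq_Ls.
  exact: (ffunE (fun x => restr L' (s x))).
apply: val_inj; apply/ffunP => -[t|x]; first exact: eq_bot.
by have := sP x; rewrite s_id.
Qed.

Definition split_labels L : labeling P * {ffun antichain k -> 'I_#|{: S}|} :=
  (restr L, [ffun t => L (bot t)]).

Lemma split_labels_inj : injective split_labels.
Proof.
move=> L L' eq_LL'; apply: restr_bot_inj => [|t]; first by have := congr1 (fun p => p.1) eq_LL'.
by have /ffunP/(_ t) := congr1 (fun p => p.2) eq_LL'; rewrite !ffunE.
Qed.

(** By cardinality: (n + k)! = n! * (n + k)^_k. *)
Lemma split_labels_onto :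
  [set split_labels L | L in [set: labeling S]] =
  setX [set: labeling P]
       [set g : {ffun antichain k -> 'I_#|{: S}|} | injectiveb g].
Proof.
apply/eqP; rewrite eqEcard cardsX card_inj_ffuns (card_imset _ split_labels_inj).
rewrite !cardsT !card_labeling; apply/andP; split.
  apply/subsetP => _ /imsetP[L _ ->]; rewrite inE /= !inE.
  by apply/injectiveP => t t'; rewrite !ffunE => eqL; exact: inl_inj (@labelingP _ L _ _ eqL).
have := ffact_fact (leq_addr #|P| k).
by rewrite !card_ord card_ordinal_sum addKn mulnC => ->.
Qed.

Lemma card_restr (A : pred (labeling P)) c : c <= #|{: S}| ->
  #|[set L : labeling S | A (restr L) && [forall t, L (bot t) < c]]| =
  #|[set M | A M]| * c ^_ k.
Proof.
move=> le_c.
have -> : c ^_ k = #|[set g : {ffun antichain k -> 'I_#|{: S}|} in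
    ffun_on [pred j : 'I_#|{: S}| | j < c] | injectiveb g]|.
  by rewrite card_inj_ffuns_on card_ord_lt // card_ord.
rewrite -cardsX -(card_imset _ split_labels_inj); apply: eq_card => -[M g].
rewrite in_setX !inE; apply/imsetP/and3P => [[L LA [-> ->]] | [AM g_on g_inj]].
  move: LA; rewrite inE => /andP[AL /forallP bnd]; split=> //.
    by apply/ffun_onP => t; rewrite ffunE inE.
  by apply/injectiveP => t t'; rewrite !ffunE => eqL; exact: inl_inj (@labelingP _ L _ _ eqL).
have /imsetP[L _ def_L] : (M, g) \in [set split_labels L | L in [set: labeling S]].
  by rewrite split_labels_onto !inE.
exists L => //; rewrite inE; case: def_L => <- def_g; rewrite AM /=.
by apply/forallP => t; have /ffun_onP/(_ t) := g_on; rewrite def_g ffunE inE.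
Qed.

(** The bound on [i] ensures that all numbers below [i + k - 1] are labels.
    Including [i = 0], where nothing is counted on either side, spares the
    first coefficient a separate treatment. *)
Lemma card_labeling_order_lt i : 0 < #|P| -> 0 < k -> i <= #|P|.+1 ->
  #|[set L : labeling S | labeling_order L < i]| =
  #|[set M : labeling P | labeling_order M < i]| * (i + k - 1) ^_ k.
Proof.
move=> P_gt0 k_gt0; case: i => [_|i lt_i].
  by rewrite !(eq_card0 (A := [set _ | _])) // => M; rewrite inE.
rewrite addSn subn1 -card_restr; last by rewrite card_ordinal_sum addnC leq_add2l.
by apply: eq_card => L; rewrite !inE ltnS labeling_order_restr_leq.
Qed.

End Restriction.

(** * Coefficients of the sorting generating function *)

Lemma coef_sorting_gf d (T : finPOrderType d) i :
  ((sorting_gf T)`_i = #|[set L : labeling T | labeling_order L == i]|%:R)%R.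
Proof.
rewrite /sorting_gf coef_sum -sum1_card natr_sum [RHS]big_mkcond /=.
by apply: eq_bigr => L _; rewrite coefXn inE eq_sym; case: eqP.
Qed.

Lemma sum_coef_sorting_gf d (T : finPOrderType d) i :
  (\sum_(j < i) (sorting_gf T)`_j = 
   #|[set L : labeling T | (labeling_order L < i)%N]|%:R)%R.
Proof.
elim: i => [|i IHi]; first by rewrite big_ord0 eq_card0 // => L; rewrite inE.
rewrite big_ord_recr /= IHi coef_sorting_gf -natrD; congr (_%:R)%R.
rewrite -cardsUI [X in _ + X]eq_card0 ?addn0 => [|L]; last first.
  by rewrite !inE; case: ltngtP.
by apply: eq_card => L; rewrite !inE ltnS orbC -leq_eqVlt.
Qed.

Local Open Scope ring_scope.

Theorem theorem5p5 (d : Order.disp_t) (P : finPOrderType d) (n k : nat)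
    (card_P : #|P| = n) (n_ge1 : (1 <= n)%N) (k_ge1 : (1 <= k)%N) :
  let f := sorting_gf P in
  let f' := sorting_gf (ordinal_sum (antichain k) P) in
  let v : 'cV[int]_n := \col_(i < n) f`_i in
  let v' : 'cV[int]_n := \col_(i < n) f'`_i in
  [/\ Xmx n k *m v = v',
      f'`_n = (n`! * k`! * 'C(n + k - 1, k - 1))%N%:R
    & forall i : nat, (n + 1 <= i <= n + k - 1)%N -> f'`_i = 0].
Proof.
move=> f f' v v'.
have P_gt0 : (0 < #|P|)%N by rewrite card_P.
pose s i : int := \sum_(j < i) f`_j; pose s' i : int := \sum_(j < i) f'`_j.
have s'E i : (i <= n.+1)%N -> s' i = s i * ((i + k - 1) ^_ k)%:R.
  move=> le_i; rewrite /s /s' !sum_coef_sorting_gf -natrM card_labeling_order_lt //.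
  by rewrite card_P.
have sS i : s i.+1 = s i + f`_i by rewrite /s big_ord_recr.
have ffactB i : ((i.+1 + k - 1) ^_ k)%:R = 
    ((i + k - 1) ^_ k)%:R + (k`! * 'C(i + k - 1, k - 1))%:R :> int.
  rewrite -natrD; congr (_%:R); case: (k) k_ge1 => // m _.
  rewrite !addnS addSn !subn1 /= -!bin_ffact binS; lia.
have f'E i : (i <= n)%N -> f'`_i =
    s i * (k`! * 'C(i + k - 1, k - 1))%:R + f`_i * ((i + k) ^_ k)%:R.
  move=> le_i; have : s' i.+1 = s' i + f'`_i by rewrite /s' big_ord_recr.
  rewrite !s'E ?ltnS // ?leqW // sS ffactB mulrDl mulrDr -addrA => /addrI <-.
  by rewrite -ffactB; congr (_ + _ * (_ ^_ _)%:R); lia.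
(* Labelings of P have order at most n - 1, so this term drops at i = n. *)
have f_n : f`_n = 0.
  rewrite coef_sorting_gf eq_card0 // => L; rewrite inE; apply/eqP => ordL.
  have := labeling_order_le L; rewrite ordL card_P.
  by case: (n) n_ge1 => // m _; rewrite ltnn.
split.
- apply/matrixP => i j; rewrite !mxE f'E; last exact: ltnW.
  rewrite /s mulr_suml (bigID (fun j : 'I_n => j < i)%N) /= [X in _ + X](bigD1 i) ?ltnn //=.
  rewrite [X in _ + (_ + X)]big1 => [|l /andP[le_il ne_li]]; last first.
    by rewrite !mxE (negPf le_il) eq_sym (negPf ne_li) mul0r.
  rewrite addr0 !mxE ltnn eqxx; congr (_ + _).
    rewrite (big_ord_narrow (ltnW (ltn_ord i))); apply: eq_bigr => l _.
    by rewrite !mxE /= ltn_ord mulrC; congr (_ * (_ * 'C(_, _))%N%:R); lia.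
  rewrite mulrC -bin_ffact mulnC; congr (_ * ('C(_, _) * _)%N%:R); lia.
- rewrite f'E // f_n mul0r addr0 /s sum_coef_sorting_gf -natrM mulnA.
  congr (_ * _ * _)%N%:R.
  rewrite -card_P -card_labeling -cardsT; apply: eq_card => L; rewrite !inE.
  by rewrite (leq_ltn_trans (labeling_order_le L)) // cardsT ltn_predL.
- move=> i /andP[lt_i _]; rewrite coef_sorting_gf eq_card0 // => L.
  have le_n : (labeling_order L <= n)%N.
    rewrite labeling_order_restr_leq //; apply/andP; split.
      by rewrite -card_P (leq_trans (labeling_order_le _)) ?leq_pred.
    by apply/forallP => t; rewrite -card_P addnC -card_ordinal_sum.
  by rewrite inE ltn_eqF // (leq_ltn_trans le_n) // -addn1.
Qed.
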